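(* Let $W_0\colon\mathrm{GL}^+(2)\to\mathbb{R}$ be defined by $$W_0(F)=\frac{\lambda_{\max}}{\lambda_{\min}}-\log\left(\frac{\lambda_{\max}}{\lambda_{\min}}\right)+\log(\lambda_{\max}\lambda_{\min})+\frac{1}{\lambda_{\max}\lambda_{\min}}=\widehat h(K(F))+f(\det F),$$ with $\widehat h\colon[1,\infty)\to\mathbb{R}$, $\widehat h(t)=t-\log t$, and $f\colon(0,\infty)\to\mathbb{R}$, $f(t)=\log t+\frac1t$, where $\lambda_{\max}\ge\lambda_{\min}>0$ are the singular values of $F\in\mathrm{GL}^+(2)$ and $K(F)=\lambda_{\max}/\lambda_{\min}$. Then $W_0$ is rank-one convex and isotropic, and for every $c\in\mathbb{R}$ the sublevel set $\{F\in\mathrm{GL}^+(2) : W_0(F)\le c\}$ is compact and connected, but $W_0$ is not polyconvex.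
   Context: $\mathrm{GL}^+(2)=\{F\in\mathbb{R}^{2\times2} : \det F>0\}$, $\mathrm{SO}(2)$ is the special orthogonal group, and $\log$ is the natural logarithm. A function $W\colon\mathrm{GL}^+(2)\to\mathbb{R}$ is called: (1) isotropic (and objective) if $W(Q_1FQ_2)=W(F)$ for all $F\in\mathrm{GL}^+(2)$ and all $Q_1,Q_2\in\mathrm{SO}(2)$; (2) rank-one convex if $W((1-t)F+t(F+H))\le(1-t)W(F)+tW(F+H)$ for all $t\in[0,1]$, all $F\in\mathrm{GL}^+(2)$ and all $H\in\mathbb{R}^{2\times2}$ with $\operatorname{rank}(H)=1$ and $F+H\in\mathrm{GL}^+(2)$ (the whole segment then lies in $\mathrm{GL}^+(2)$, since $\det$ is affine along rank-one directions); (3) polyconvex if there exists a convex function $P\colon\mathbb{R}^{2\times2}\times\mathbb{R}\cong\mathbb{R}^5\to\mathbb{R}\cup\{+\infty\}$ such that $W(F)=P(F,\det F)$ for all $F\in\mathrm{GL}^+(2)$. The empty set is regarded as connected and compact. *)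

(* Defs.v *)
From mathcomp Require Import all_boot all_order all_algebra.
From mathcomp Require Import all_classical all_reals all_analysis.
Set Implicit Arguments.
Unset Strict Implicit.
Unset Printing Implicit Defensive.
Import Order.TTheory GRing.Theory Num.Theory.
Import numFieldNormedType.Exports.
Local Open Scope classical_set_scope.
Local Open Scope ring_scope.

(* Functions on GL^+(2) are represented by functions on all 2x2 matrices;
   the properties of W defined below only involve values of W on [GLp2]. *)
Section Defs.
Context {R : realType}.

Definition GLp2 : set 'M[R]_2 := [set F | 0 < \det F].

Definition SO2 : set 'M[R]_2 := [set Q | Q^T *m Q = 1%:M /\ \det Q = 1].

Definition isotropic (W : 'M[R]_2 -> R) : Prop :=
  forall F Q1 Q2 : 'M[R]_2, GLp2 F -> SO2 Q1 -> SO2 Q2 ->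
    W (Q1 *m F *m Q2) = W F.

Definition rank_one_convex (W : 'M[R]_2 -> R) : Prop :=
  forall (t : R) (F H : 'M[R]_2), 0 <= t <= 1 -> GLp2 F ->
    \rank H = 1%N -> GLp2 (F + H) ->
    W ((1 - t) *: F + t *: (F + H)) <= (1 - t) * W F + t * W (F + H).

(* Convexity with values in R U {+oo}. Since 0 * +oo = 0 in [\bar R], the
   inequality is trivial at t = 0 and t = 1. *)
Definition econvex (E : lmodType R) (P : E -> \bar R) : Prop :=
  (forall x, P x != -oo%E) /\
  (forall (t : R) (x y : E), 0 <= t <= 1 ->
    (P ((1 - t) *: x + t *: y)%R <= (1 - t)%:E * P x + t%:E * P y)%E).

Definition polyconvex (W : 'M[R]_2 -> R) : Prop :=
  exists P : ('M[R]_2 * R^o)%type -> \bar R,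
    econvex P /\ forall F, GLp2 F -> (W F)%:E = P (F, \det F).

Definition singular_values (F : 'M[R]_2) : set R :=
  [set s | 0 <= s /\ eigenvalue (F^T *m F) (s ^+ 2)].

(* The set of singular values is finite and nonempty, so that this supremum
   and infimum are a maximum and a minimum. *)
Definition lambda_max (F : 'M[R]_2) : R := sup (singular_values F).
Definition lambda_min (F : 'M[R]_2) : R := inf (singular_values F).

Definition distortion (F : 'M[R]_2) : R := lambda_max F / lambda_min F.

Definition hhat (t : R) : R := t - ln t.

Definition fvol (t : R) : R := ln t + t^-1.

Definition W0 (F : 'M[R]_2) : R :=
  lambda_max F / lambda_min F - ln (lambda_max F / lambda_min F)
  + ln (lambda_max F * lambda_min F) + (lambda_max F * lambda_min F)^-1.

Definition sublevel (W : 'M[R]_2 -> R) (c : R) : set 'M[R]_2 :=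
  [set F | GLp2 F /\ W F <= c].

End Defs.

(* Main.v *)
Require Import Defs.
From mathcomp Require Import all_boot all_order all_algebra.
From mathcomp Require Import all_classical all_reals all_analysis.
From mathcomp Require Import ring lra.
Import Order.TTheory GRing.Theory Num.Theory.
Import numFieldNormedType.Exports.
Local Open Scope classical_set_scope.
Local Open Scope ring_scope.

(** Write M >= m for the singular values, K = M/m, D = Mm. The logarithms in [W0] combine, so W0 =
    M/m + 2 ln m + 1/D. Rank-one convexity: it is enough to find, at every F and along every
    direction H with det H = 0, a supporting line ([W0_support]). The singular value decomposition
    [svd2] and isotropy reduce F to diag(M, m). Along the line det is affine, so 1/D lies above its
    tangent. For M/m + 2 ln m the logarithms are replaced by rational lower bounds chosen so that
    only D and N = M^2 + m^2, both polynomial in the matrix entries, remain; the claim then becomes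
    a sum-of-squares inequality ([scalar_support1]). Failure of polyconvexity: (9 I, 81) is a convex
    combination of (I, 1), (diag(21,6), 126) and (diag(6,21), 126), and the values of [W0] at these
    four points violate convexity. Sublevel sets: W0 = (K - ln K) + (1/D - ln(1/D)), so W0 <= c
    bounds the entries and keeps det away from 0 ([sublevel_bounds]), which gives compactness. In
    logarithmic coordinates this is (e^s - s) + (e^r - r) with s = ln K and r = -ln D. Each term
    decreases as s or r shrinks to 0, so the path that scales rotation angles and log singular
    values by t joins I to F inside the sublevel set. *)

Section LogBounds.

(** * Rational bounds for the logarithm *)

Variable R : realType.

Lemma is_derive_ndecr1 (f df : R -> R) (x : R) :
  (forall z : R, 0 < z -> is_derive z (1 : R) f (df z)) ->
  (forall z : R, 1 <= z -> 0 <= df z) -> 1 <= x -> f 1 <= f x.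
Proof.
move=> fdf df0 x1; apply: (@ger0_derive1_ndecry R f 1) => // [z|z|].
- by rewrite in_itv/= andbT => z1; have [] := fdf z (lt_trans ltr01 z1).
- rewrite in_itv/= andbT => z1; rewrite derive1E.
  by have -> := @derive_val _ _ _ _ _ _ _ (fdf z (lt_trans ltr01 z1)); apply/df0/ltW.
- apply: derivable_within_continuous => z; rewrite in_itv/= andbT => z1.
  by have [] := fdf z (lt_le_trans ltr01 z1).
Qed.

(** The left side is 2 - 4/(x+1), and ln x + 4/(x+1) has derivative (x-1)^2 / (x (x+1)^2), which is
    nonnegative. *)
Lemma ln_ge_pade (x : R) : 1 <= x -> 2 * (x - 1) / (x + 1) <= ln x.
Proof.
move=> x1.
have df (z : R) : 0 < z -> is_derive z (1 : R) (fun y : R => ln y + 4 * (y + 1)^-1)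
    (z^-1 - 4 / (z + 1) ^+ 2).
  move=> z0; have z1 : z + 1 != 0 by lra.
  have /= ? := is_derive1_ln z0.
  have ? := @is_deriveV R (fun y : R => y + 1) z (1 + 0) (1 : R) z1 _.
  apply: is_derive_eq; rewrite /GRing.scale /=.
  by field; rewrite z1 gt_eqF.
have := is_derive_ndecr1 _ _ _ df _ x1; rewrite ln1 => le1.
have {le1} : 0 + 4 * (1 + 1)^-1 <= ln x + 4 * (x + 1)^-1.
  apply: le1 => z z1.
  have -> : z^-1 - 4 / (z + 1) ^+ 2 = (z - 1) ^+ 2 / (z * (z + 1) ^+ 2).
    by field; apply/andP; split; lra.
  by rewrite divr_ge0 ?sqr_ge0// mulr_ge0 ?sqr_ge0//; lra.
suff -> : 2 * (x - 1) / (x + 1) = 0 + 4 * (1 + 1)^-1 - 4 * (x + 1)^-1 by lra.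
by field; lra.
Qed.

Lemma ln_le_pade (x : R) : 1 <= x -> ln x <= (x - x^-1) / 2.
Proof.
move=> x1.
have df (z : R) : 0 < z -> is_derive z (1 : R) (fun y : R => 2^-1 * (y - y^-1) - ln y)
    (2^-1 * (1 + (z ^+ 2)^-1) - z^-1).
  move=> z0; have z1 : z != 0 by lra.
  have /= ? := is_derive1_ln z0.
  have ? := @is_deriveV R id z 1 (1 : R) z1 _.
  apply: is_derive_eq; rewrite /GRing.scale /=.
  by field.
have := is_derive_ndecr1 _ _ _ df _ x1; rewrite ln1 => le1.
have {le1} : 2^-1 * (1 - 1^-1) - 0 <= 2^-1 * (x - x^-1) - ln x.
  apply: le1 => z z1.
  have -> : 2^-1 * (1 + (z ^+ 2)^-1) - z^-1 = (1 - z^-1) ^+ 2 / 2 by field; lra.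
  by rewrite divr_ge0 ?sqr_ge0.
by rewrite invr1; lra.
Qed.

End LogBounds.

(** * The supporting-line inequality for M/m + 2 ln m *)

Section ScalarSupport.
Variable R : realType.

(** The bound touches ln at y = 1. Its form is dictated by its use with y = m^2 and D = Mm: added to
    M/m = D/y it gives (N + D - 1)/(1 + D) with N = y + D^2/y. On each side of 1 it lies below one
    of the two previous bounds, by an explicit square. *)
Lemma ln_ge_tangent (y D : R) : 0 < y -> y <= D -> 1 <= D ->
  (y - 1) * (y + D) / (y * (1 + D)) <= ln y.
Proof.
move=> y0 yD D1; have D0 : 0 < 1 + D by lra.
have [y1|y1] := leP 1 y.
  apply: le_trans (ln_ge_pade _ _ y1); rewrite -subr_ge0.
  have -> : 2 * (y - 1) / (y + 1) - (y - 1) * (y + D) / (y * (1 + D)) =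
    (y - 1) ^+ 2 * (D - y) / (y * (1 + D) * (y + 1)).
    by field; lra.
  by apply: divr_ge0; repeat (exact: sqr_ge0 || apply: mulr_ge0); lra.
have iy : 1 <= y^-1 by rewrite invf_ge1// ltW.
have := ln_le_pade _ _ iy; rewrite lnV ?posrE// invrK => yl.
suff : 0 <= - ((y^-1 - y) / 2) - (y - 1) * (y + D) / (y * (1 + D)) by lra.
have -> : - ((y^-1 - y) / 2) - (y - 1) * (y + D) / (y * (1 + D)) =
    (y - 1) ^+ 2 * (D - 1) / (2 * y * (1 + D)).
  by field; lra.
by apply: divr_ge0; repeat (exact: sqr_ge0 || apply: mulr_ge0); lra.
Qed.

(** Here M, m are the singular values of diag(k, 1) plus a singular matrix with diagonal A, B and
    off-diagonal p, q. The coefficients 1 and 2 - k are the partial derivatives of M/m + 2 ln m at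
    (k, 1). *)
Lemma scalar_support1 (k A B p q M m : R) : 1 <= k -> 0 < m -> m <= M ->
  A * B = p * q ->
  M ^+ 2 + m ^+ 2 = (k + A) ^+ 2 + (1 + B) ^+ 2 + p ^+ 2 + q ^+ 2 ->
  M * m = (k + A) * (1 + B) - p * q ->
  k + (A + B * (2 - k)) <= M / m + 2 * ln m.
Proof.
move=> k1 m0 mM AB.
set D := M * m; set N := M ^+ 2 + _ => NE DE.
have M0 : 0 < M by lra.
have D0 : 0 < D by rewrite mulr_gt0.
have DE' : D = k + A + k * B by rewrite DE; lra.
(* For D >= 1 a bound on ln(m^2) suffices; for D < 1 the term 2 ln m is split as ln D - ln(M/m) and
   both parts are estimated. *)
have [D1|D1] := leP 1 D.
  have y0 : 0 < m ^+ 2 by rewrite exprn_gt0.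
  have yD : m ^+ 2 <= D by rewrite expr2 ler_wpM2r// ltW.
  have := ln_ge_tangent _ _ y0 yD D1.
  rewrite lnXn// -mulr_natl => lny.
  suff : k + (A + B * (2 - k)) <=
      M / m + (m ^+ 2 - 1) * (m ^+ 2 + D) / (m ^+ 2 * (1 + D)).
    by lra.
  have -> : M / m + (m ^+ 2 - 1) * (m ^+ 2 + D) / (m ^+ 2 * (1 + D)) =
     (N + D - 1) / (1 + D).
    by rewrite /N /D; field; rewrite -/D; lra.
  rewrite ler_pdivlMr; last by lra.
  rewrite -subr_ge0 NE.
  have -> : (k + A) ^+ 2 + (1 + B) ^+ 2 + p ^+ 2 + q ^+ 2 + D - 1 -
    (k + (A + B * (2 - k))) * (1 + D) = (p - q) ^+ 2 + ((k - 1) * B) ^+ 2 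
     + 2 * (p * q - A * B).
    by rewrite DE'; ring.
  by rewrite AB subrr mulr0 addr0 addr_ge0 ?sqr_ge0.
have iD1 : 1 <= D^-1 by rewrite invf_ge1// ltW.
have K1 : 1 <= M / m by rewrite ler_pdivlMr// mul1r.
have := ln_le_pade _ _ iD1; have := ln_le_pade _ _ K1.
rewrite invrK lnV ?posrE// invf_div ln_div ?posrE// lnM ?posrE// => lnK lnD.
suff : k + (A + B * (2 - k)) <= M / m - (M / m - m / M) / 2 - (D^-1 - D) / 2.
  by lra.
have -> : M / m - (M / m - m / M) / 2 - (D^-1 - D) / 2 = (N + D ^+ 2 - 1) / (2 * D).
  by rewrite /N /D; field; lra.
rewrite ler_pdivlMr ?mulr_gt0// -subr_ge0 NE.
have -> : (k + A) ^+ 2 + (1 + B) ^+ 2 + p ^+ 2 + q ^+ 2 + D ^+ 2 - 1 -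
    (k + (A + B * (2 - k))) * (2 * D) = p ^+ 2 + q ^+ 2 - 2 * A * B
     + ((k - 1) * B) ^+ 2 - 2 * ((k - 1) * B) * (1 - D).
  by rewrite DE'; ring.
(* For B <= 0 every term is nonnegative, since p^2 + q^2 - 2AB = (p - q)^2. For B > 0, D < 1 forces
   -A > k - 1, so p^2 + q^2 - 2AB >= -4AB >= 4(k-1)B, which absorbs the negative term. *)
have [B0|B0] := leP B 0.
  have : 0 <= (k - 1) * (- B) * (1 - D) by rewrite !mulr_ge0//; lra.
  have := sqr_ge0 (p - q); have := sqr_ge0 ((k - 1) * B).
  by rewrite sqrrB; lra.
have : 0 <= p ^+ 2 + q ^+ 2 + 2 * A * B.
  by have := sqr_ge0 (p + q); rewrite sqrrD; lra.
have : 0 <= (- A - (k - 1)) * B by rewrite mulr_ge0//; nra.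
have : 0 <= (k - 1) * B * D by rewrite !mulr_ge0//; lra.
have := sqr_ge0 ((k - 1) * B).
by nra.
Qed.

(** Scaling by 1/m reduces to the previous lemma with k = M/m: the ratio is unchanged and 2 ln
    shifts by a constant. *)
Lemma scalar_support (M m A B p q M1 m1 : R) : 0 < m -> m <= M -> 0 < m1 -> m1 <= M1 ->
  A * B = p * q ->
  M1 ^+ 2 + m1 ^+ 2 = (M + A) ^+ 2 + (m + B) ^+ 2 + p ^+ 2 + q ^+ 2 ->
  M1 * m1 = (M + A) * (m + B) - p * q ->
  M / m + 2 * ln m + (m * A + (2 * m - M) * B) / m ^+ 2 <= M1 / m1 + 2 * ln m1.
Proof.
move=> m0 mM m10 mM1 AB NE DE.
have nm : m != 0 by lra.
have : M / m + (A / m + B / m * (2 - M / m)) <= M1 / m / (m1 / m) + 2 * ln (m1 / m).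
  apply: (@scalar_support1 _ _ _ (p / m) (q / m)).
  - by rewrite ler_pdivlMr// mul1r.
  - by rewrite divr_gt0.
  - by rewrite ler_pM2r ?invr_gt0.
  - by rewrite mulrACA AB mulrACA.
  - have -> : (M1 / m) ^+ 2 + (m1 / m) ^+ 2 = (M1 ^+ 2 + m1 ^+ 2) / m ^+ 2 by field.
    by rewrite NE; field.
  - by rewrite mulrACA DE; field.
rewrite ln_div ?posrE// -[M1 / m / _]mulf_div.
have -> : M1 / m1 * (m^-1 / m^-1) = M1 / m1 by field; lra.
have -> : (m * A + (2 * m - M) * B) / m ^+ 2 = A / m + B / m * (2 - M / m).
  by field.
by lra.
Qed.

End ScalarSupport.

(** * Singular values, rotations and singular value decomposition of 2x2 matrices *)

Section TwoByTwo.
Variable R : realType.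
Implicit Types (F G H Q : 'M[R]_2).

Definition mat2 (a b c d : R) : 'M[R]_2 :=
  \matrix_(i, j) if i == 0 then (if j == 0 then a else b)
                 else (if j == 0 then c else d).

Lemma ord2P (P : 'I_2 -> Prop) : P 0 -> P 1 -> forall i, P i.
Proof.
move=> P0 P1 [[|[|//]] i2].
- by rewrite (_ : Ordinal i2 = 0)//; exact: val_inj.
- by rewrite (_ : Ordinal i2 = 1)//; exact: val_inj.
Qed.

Lemma matrix2P F G : F 0 0 = G 0 0 -> F 0 1 = G 0 1 -> F 1 0 = G 1 0 ->
  F 1 1 = G 1 1 -> F = G.
Proof. by move=> *; apply/matrixP; do 2![apply: ord2P]. Qed.

Lemma mat2K F : F = mat2 (F 0 0) (F 0 1) (F 1 0) (F 1 1).
Proof. by apply: matrix2P; rewrite !mxE. Qed.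

Lemma det_mat2 (a b c d : R) : \det (mat2 a b c d) = a * d - b * c.
Proof.
rewrite (expand_det_row _ 0) !big_ord_recl big_ord0 /cofactor !det_mx11 !mxE /=.
rewrite expr0 expr1.
ring.
Qed.

Lemma mul_mat2 (a b c d a' b' c' d' : R) : mat2 a b c d *m mat2 a' b' c' d' =
  mat2 (a * a' + b * c') (a * b' + b * d') (c * a' + d * c') (c * b' + d * d').
Proof.
by apply: matrix2P; rewrite !mxE !big_ord_recl big_ord0 !mxE /= addr0.
Qed.

Lemma add_mat2 (a b c d a' b' c' d' : R) : mat2 a b c d + mat2 a' b' c' d' =
  mat2 (a + a') (b + b') (c + c') (d + d').
Proof. by apply: matrix2P; rewrite !mxE. Qed.

Lemma opp_mat2 (a b c d : R) : - mat2 a b c d = mat2 (- a) (- b) (- c) (- d).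
Proof. by apply: matrix2P; rewrite !mxE. Qed.

Lemma scale_mat2 (t a b c d : R) :
  t *: mat2 a b c d = mat2 (t * a) (t * b) (t * c) (t * d).
Proof. by apply: matrix2P; rewrite !mxE. Qed.

Lemma tr_mat2 (a b c d : R) : (mat2 a b c d)^T = mat2 a c b d.
Proof. by apply: matrix2P; rewrite !mxE. Qed.

Lemma scalar_mat2 (a : R) : a%:M = mat2 a 0 0 a.
Proof. by apply: matrix2P; rewrite !mxE. Qed.

Lemma eigenvalue_mat2 (a b c d x : R) :
  eigenvalue (mat2 a b c d) x = ((a - x) * (d - x) - b * c == 0).
Proof.
rewrite /eigenvalue /eigenspace kermx_eq0 row_free_unit unitmxE unitfE.
by rewrite scalar_mat2 opp_mat2 add_mat2 det_mat2 !subr0 negbK.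
Qed.

(** The trace of F^T F is M^2 + m^2 and its determinant is (Mm)^2, so its characteristic polynomial
    at s^2 factors as (s^2 - m^2)(s^2 - M^2). *)
Lemma singular_values_mat2 (a b c d M m : R) : 0 < m -> m <= M ->
  M ^+ 2 + m ^+ 2 = a ^+ 2 + b ^+ 2 + c ^+ 2 + d ^+ 2 -> M * m = a * d - b * c ->
  singular_values (mat2 a b c d) = [set m; M].
Proof.
move=> m0 mM NE DE; have M0 : 0 < M by exact: lt_le_trans mM.
have charE s : eigenvalue ((mat2 a b c d)^T *m mat2 a b c d) (s ^+ 2) =
    ((s ^+ 2 == m ^+ 2) || (s ^+ 2 == M ^+ 2)).
  rewrite tr_mat2 mul_mat2 eigenvalue_mat2.
  rewrite -(subr_eq0 _ (m ^+ 2)) -(subr_eq0 _ (M ^+ 2)) -mulf_eq0.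
  congr (_ == 0).
  have -> : (s ^+ 2 - m ^+ 2) * (s ^+ 2 - M ^+ 2) =
    s ^+ 2 * s ^+ 2 - (M ^+ 2 + m ^+ 2) * s ^+ 2 + (M * m) ^+ 2 by ring.
  by rewrite NE DE; ring.
have [m0' M0'] := (ltW m0, ltW M0).
apply/seteqP; split => s.
  by move=> [s0]; rewrite charE !eqrXn2// => /orP[]/eqP; [left|right].
by case=> ->; split; rewrite ?charE ?eqxx ?orbT.
Qed.

Lemma lambda_mat2 (a b c d M m : R) : 0 < m -> m <= M ->
  M ^+ 2 + m ^+ 2 = a ^+ 2 + b ^+ 2 + c ^+ 2 + d ^+ 2 -> M * m = a * d - b * c ->
  lambda_max (mat2 a b c d) = M /\ lambda_min (mat2 a b c d) = m.
Proof.
move=> m0 mM NE DE; rewrite /lambda_max /lambda_min (singular_values_mat2 _ _ _ _ M m)//.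
split.
  by rewrite sup_setU ?sup1// => _ _ -> ->.
apply/eqP; rewrite eq_le; apply/andP; split.
  by apply: ge_inf; [exists m => _ [] ->|left].
by apply: lb_le_inf => [|_ [] ->//]; exists m; left.
Qed.

Lemma W0_mat2 (a b c d M m : R) : 0 < m -> m <= M ->
  M ^+ 2 + m ^+ 2 = a ^+ 2 + b ^+ 2 + c ^+ 2 + d ^+ 2 -> M * m = a * d - b * c ->
  W0 (mat2 a b c d) = M / m + 2 * ln m + (M * m)^-1.
Proof.
move=> m0 mM NE DE; have M0 : 0 < M by exact: lt_le_trans mM.
have [lM lm] := lambda_mat2 _ _ _ _ _ _ m0 mM NE DE.
by rewrite /W0 lM lm ln_div ?posrE// lnM ?posrE//; ring.
Qed.

Lemma singular_values_exist (a b c d : R) : 0 < a * d - b * c ->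
  exists M m : R, [/\ 0 < m, m <= M,
  M ^+ 2 + m ^+ 2 = a ^+ 2 + b ^+ 2 + c ^+ 2 + d ^+ 2 & M * m = a * d - b * c].
Proof.
move=> D0.
(* These are z = M + m and w = M - m: their squares are N + 2D and N - 2D. *)
pose z := Num.sqrt ((a + d) ^+ 2 + (b - c) ^+ 2).
pose w := Num.sqrt ((a - d) ^+ 2 + (b + c) ^+ 2).
have z2 : z ^+ 2 = (a + d) ^+ 2 + (b - c) ^+ 2 by rewrite sqr_sqrtr// addr_ge0 ?sqr_ge0.
have w2 : w ^+ 2 = (a - d) ^+ 2 + (b + c) ^+ 2 by rewrite sqr_sqrtr// addr_ge0 ?sqr_ge0.
have wz : w < z by rewrite -(@ltr_pXn2r _ 2) ?nnegrE ?sqrtr_ge0// z2 w2; nra.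
have w0 : 0 <= w by exact: sqrtr_ge0.
exists ((z + w) / 2), ((z - w) / 2); split; lra.
Qed.

Lemma SO2_mat2 Q : SO2 Q -> exists x y : R, x ^+ 2 + y ^+ 2 = 1 /\ Q = mat2 x (- y) y x.
Proof.
case; rewrite (mat2K Q); move: (Q 0 0) (Q 0 1) (Q 1 0) (Q 1 1) => a b c d.
rewrite tr_mat2 mul_mat2 det_mat2 scalar_mat2 => /matrixP QQ D1.
have := QQ 0 0; have := QQ 1 1; rewrite !mxE /= => bd ac.
(* This sum is the squared norm of Q, equal to 2, minus twice its determinant 1. *)
have ad : (a - d) ^+ 2 + (b + c) ^+ 2 = 0.
  transitivity ((a * a + c * c) + (b * b + d * d) - 2 * (a * d - b * c)); first by ring.
  by rewrite ac bd D1; ring.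
move/eqP: ad; rewrite paddr_eq0 ?sqr_ge0// !sqrf_eq0 subr_eq0 addr_eq0.
move=> /andP[/eqP ad /eqP bc].
by exists a, c; split; [rewrite !expr2|rewrite bc -ad].
Qed.

Lemma mat2_SO2 (x y : R) : x ^+ 2 + y ^+ 2 = 1 -> SO2 (mat2 x (- y) y x).
Proof.
move=> xy; split; last by rewrite det_mat2 -xy; ring.
by rewrite tr_mat2 mul_mat2 scalar_mat2 -xy; congr mat2; ring.
Qed.

Lemma det_SO2 F Q1 Q2 : SO2 Q1 -> SO2 Q2 -> \det (Q1 *m F *m Q2) = \det F.
Proof. by move=> [_ d1] [_ d2]; rewrite !det_mulmx d1 d2 mul1r mulr1. Qed.

(** Rotations preserve the sum of squared entries and the determinant, hence the pair (M, m) that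
    determines [W0]. *)
Lemma W0_isotropic : isotropic (@W0 R).
Proof.
move=> F Q1 Q2; rewrite /GLp2 /= => F0 S1 S2.
have := det_SO2 F _ _ S1 S2.
have [x [y [xy ->]]] := SO2_mat2 _ S1; have [z [t [zt ->]]] := SO2_mat2 _ S2.
rewrite {}(mat2K F) in F0 *; move: (F 0 0) (F 0 1) (F 1 0) (F 1 1) F0 => a b c d.
rewrite !mul_mat2 !det_mat2 => /singular_values_exist[M [m [m0 mM NE DE]]] dE.
rewrite (W0_mat2 a b c d M m)// (W0_mat2 _ _ _ _ M m)//; last by rewrite dE.
rewrite NE; apply/esym.
transitivity ((x ^+ 2 + y ^+ 2) * (z ^+ 2 + t ^+ 2) *
  (a ^+ 2 + b ^+ 2 + c ^+ 2 + d ^+ 2)).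
  by ring.
by rewrite xy zt !mul1r.
Qed.

Lemma unit_vector (x y : R) : ~~ ((x == 0) && (y == 0)) ->
  exists2 r : R, r != 0 & (x / r) ^+ 2 + (y / r) ^+ 2 = 1.
Proof.
move=> xy0; exists (Num.sqrt (x ^+ 2 + y ^+ 2)).
  rewrite sqrtr_eq0 -ltNge lt_def addr_ge0 ?sqr_ge0// andbT.
  by rewrite paddr_eq0 ?sqr_ge0// !sqrf_eq0.
rewrite !expr_div_n sqr_sqrtr ?addr_ge0 ?sqr_ge0// -mulrDl divff//.
by rewrite paddr_eq0 ?sqr_ge0// !sqrf_eq0.
Qed.

Lemma sym_eigenvector (p q r M m : R) : M + m = p + r -> M * m = p * r - q * q ->
  exists x y : R, [/\ x ^+ 2 + y ^+ 2 = 1, p * x + q * y = M * x & q * x + r * y = M * y].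
Proof.
move=> tE dE; have [/andP[/eqP q0 /eqP p0]|xy0] := boolP ((q == 0) && (M - p == 0)).
  exists 1, 0; rewrite q0 !(mulr0, mulr1, mul0r, expr1n, expr0n, addr0)/=; split=> //.
  by lra.
(* The vector (q, M - p) solves the first eigenvector equation identically; it vanishes only in the
   case treated above. *)
have [s s0 s1] := unit_vector _ _ xy0.
exists (q / s), ((M - p) / s); split => //; first by field.
suff E : q * q + r * (M - p) = M * (M - p).
  by rewrite !mulrA -mulrDl E.
have mE : m = p + r - M by lra.
by rewrite mE in dE; lra.
Qed.

(** A unit eigenvector (x, y) of F^T F for M^2 is sent by F to M (u, v) with (u, v) a unit vector.
    The image (g, h) of (-y, x) is orthogonal to (u, v), and the determinant makes it m (-v, u). So
    (u, v) gives [Q1] and (x, y) gives [Q2]. *)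
Lemma svd2 F : GLp2 F -> exists Q1 Q2 (M m : R), [/\ SO2 Q1, SO2 Q2, 0 < m, m <= M &
  F = Q1 *m mat2 M 0 0 m *m Q2].
Proof.
rewrite /GLp2 /= (mat2K F); move: (F 0 0) (F 0 1) (F 1 0) (F 1 1) => a b c d.
rewrite det_mat2 => /singular_values_exist[M [m [m0 mM NE DE]]].
have M0 : M != 0 by rewrite gt_eqF// (lt_le_trans m0).
have tE : M ^+ 2 + m ^+ 2 = (a * a + c * c) + (b * b + d * d) by rewrite NE; ring.
have dE : M ^+ 2 * m ^+ 2 =
    (a * a + c * c) * (b * b + d * d) - (a * b + c * d) * (a * b + c * d).
  by rewrite -exprMn DE; ring.
have [x [y [xy e1 e2]]] := sym_eigenvector _ _ _ _ _ tE dE.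
pose u := (a * x + b * y) / M; pose v := (c * x + d * y) / M.
have Mu : a * x + b * y = M * u by rewrite /u; field.
have Mv : c * x + d * y = M * v by rewrite /v; field.
have uv : u ^+ 2 + v ^+ 2 = 1.
  apply: (@mulfI _ (M ^+ 2)); first by rewrite expf_neq0.
  transitivity ((M * u) ^+ 2 + (M * v) ^+ 2); first by ring.
  rewrite -Mu -Mv mulr1 -[RHS]mulr1 -xy.
  transitivity (x * (M ^+ 2 * x) + y * (M ^+ 2 * y)); last by ring.
  by rewrite -e1 -e2; ring.
pose g := b * x - a * y; pose h := d * x - c * y.
have gh1 : g * u + h * v = 0.
  apply: (mulfI M0); rewrite mulr0.
  transitivity (g * (M * u) + h * (M * v)); first by ring.
  rewrite -Mu -Mv.
  transitivity (x * (M ^+ 2 * y) - y * (M ^+ 2 * x)); last by ring.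
  by rewrite -e1 -e2 /g /h; ring.
have gh2 : u * h - v * g = m.
  apply: (mulfI M0); transitivity ((M * u) * h - (M * v) * g); first by ring.
  rewrite -Mu -Mv DE -[RHS]mulr1 -xy /g /h; ring.
have gE : g = - v * m.
  transitivity (u * (g * u + h * v) - v * (u * h - v * g)).
    by rewrite -[LHS]mulr1 -uv; ring.
  by rewrite gh1 gh2; ring.
have hE : h = u * m.
  transitivity (v * (g * u + h * v) + u * (u * h - v * g)).
    by rewrite -[LHS]mulr1 -uv; ring.
  by rewrite gh1 gh2; ring.
exists (mat2 u (- v) v u), (mat2 x (- - y) (- y) x), M, m; split=> //.
- exact: mat2_SO2.
- by apply: mat2_SO2; rewrite sqrrN.
have solve p q : p = (p * x + q * y) * x - (q * x - p * y) * y /\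
    q = (p * x + q * y) * y + (q * x - p * y) * x.
  by split; rewrite -[LHS]mulr1 -xy; ring.
rewrite !mul_mat2; congr mat2.
- by rewrite (solve a b).1 Mu -/g gE; ring.
- by rewrite (solve a b).2 Mu -/g gE; ring.
- by rewrite (solve c d).1 Mv -/h hE; ring.
- by rewrite (solve c d).2 Mv -/h hE; ring.
Qed.

End TwoByTwo.

(** * Supporting lines and rank-one convexity *)

Section RankOneConvexity.
Variable R : realType.
Implicit Types (F H : 'M[R]_2).

Lemma SO2_sandwich (Q1 Q2 H : 'M[R]_2) : SO2 Q1 -> SO2 Q2 ->
  H = Q1 *m (Q1^T *m H *m Q2^T) *m Q2.
Proof.
move=> [q1 _] [q2 _].
by rewrite !mulmxA (mulmx1C q1) mul1mx -mulmxA q2 mulmx1.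
Qed.

Lemma inv_tangent (x y : R) : 0 < x -> 0 < y -> x^-1 - (y - x) / x ^+ 2 <= y^-1.
Proof.
move=> x0 y0; rewrite -subr_ge0.
have -> : y^-1 - (x^-1 - (y - x) / x ^+ 2) = (y - x) ^+ 2 / (x ^+ 2 * y).
  by field; lra.
by rewrite divr_ge0 ?sqr_ge0// mulr_ge0 ?sqr_ge0// ltW.
Qed.

Lemma W0_support F H : GLp2 F -> \det H = 0 ->
  exists s : R, forall t : R, GLp2 (F + t *: H) -> W0 F + t * s <= W0 (F + t *: H).
Proof.
move=> F0 H0; have [Q1 [Q2 [M [m [S1 S2 m0 mM FE]]]]] := svd2 _ _ F0.
have M0 : 0 < M by exact: lt_le_trans mM.
pose K := Q1^T *m H *m Q2^T.
have HE : H = Q1 *m K *m Q2 by exact: SO2_sandwich.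
have {H0} K0 : \det K = 0 by rewrite -H0 HE (det_SO2 _ K _ _ S1 S2).
clearbody K; move: K0 HE; rewrite (mat2K _ K).
move: (K 0 0) (K 0 1) (K 1 0) (K 1 1) => A p q B K0 HE.
rewrite det_mat2 in K0.
(* The slope is the gradient of M/m + 2 ln m + 1/(Mm) at (M, m) applied to the diagonal (A, B) of
   the rotated direction. *)
exists ((m * A + (2 * m - M) * B) / m ^+ 2 - (m * A + M * B) / (M * m) ^+ 2) => t.
have -> : F + t *: H = Q1 *m mat2 R (M + t * A) (t * p) (t * q) (m + t * B) *m Q2.
  rewrite FE HE scalemxAl scalemxAr -mulmxDl -mulmxDr scale_mat2 add_mat2.
  by rewrite !add0r.
move: F0; rewrite /GLp2/= FE !det_SO2// => D0 Dt.
rewrite !W0_isotropic//; move: D0 Dt; rewrite !det_mat2 => D0 Dt.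
have [M1 [m1 [m10 mM1 NE DE]]] := singular_values_exist _ _ _ _ _ Dt.
rewrite (W0_mat2 _ _ _ _ _ _ _ m0 mM); [|by ring|by ring].
rewrite (W0_mat2 _ _ _ _ _ _ _ m10 mM1 NE DE).
have AB : A * B = p * q by lra.
have tAB : t * A * (t * B) = t * p * (t * q).
  by rewrite mulrACA AB mulrACA.
have NE' : M1 ^+ 2 + m1 ^+ 2 =
    (M + t * A) ^+ 2 + (m + t * B) ^+ 2 + (t * p) ^+ 2 + (t * q) ^+ 2.
  by rewrite NE; ring.
have le1 := scalar_support _ _ _ _ _ _ _ _ _ m0 mM m10 mM1 tAB NE' DE.
have Mm0 : 0 < M * m by rewrite mulr_gt0.
have Mm1 : 0 < M1 * m1 by rewrite mulr_gt0// (lt_le_trans m10).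
have le2 := inv_tangent _ _ Mm0 Mm1.
(* The determinant is affine in t because AB = pq cancels the quadratic term. *)
have dE : M1 * m1 - M * m = t * (m * A + M * B).
  have -> : t * (m * A + M * B) =
    (M + t * A) * (m + t * B) - t * t * (A * B) - M * m by ring.
  by rewrite AB DE; ring.
rewrite dE in le2.
have E1 : (m * (t * A) + (2 * m - M) * (t * B)) / m ^+ 2 =
  t * ((m * A + (2 * m - M) * B) / m ^+ 2) by ring.
rewrite E1 in le1.
have E2 : t * (m * A + M * B) / (M * m) ^+ 2 =
  t * ((m * A + M * B) / (M * m) ^+ 2) by ring.
rewrite E2 in le2.
by rewrite mulrBr; lra.
Qed.

Lemma det_rank_one F H (t : R) : \det H = 0 ->
  \det (F + t *: H) = (1 - t) * \det F + t * \det (F + H).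
Proof.
rewrite (mat2K _ F) (mat2K _ H) scale_mat2 !add_mat2 !det_mat2 => H0.
have HE : H 0 0 * H 1 1 = H 0 1 * H 1 0 by lra.
apply/eqP; rewrite -subr_eq0; apply/eqP.
transitivity ((t ^+ 2 - t) * (H 0 0 * H 1 1 - H 0 1 * H 1 0)); first by ring.
by rewrite H0 mulr0.
Qed.

Lemma W0_rank_one_convex : rank_one_convex (@W0 R).
Proof.
move=> t F H /andP[t0 t1] F0 rH FH0.
have H0 : \det H = 0.
  apply/eqP; apply/negPn/negP => dH.
  by have /mxrank_unit : H \in unitmx by [rewrite unitmxE unitfE]; rewrite rH.
have G0 : GLp2 (F + t *: H).
  move: F0 FH0; rewrite /GLp2/= => F0 FH0; rewrite det_rank_one//.
  have [->|tn0] := eqVneq t 0; first by rewrite subr0 mul1r mul0r addr0.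
  have : 0 < t * \det (F + H) by rewrite mulr_gt0// lt_neqAle eq_sym tn0.
  have : 0 <= (1 - t) * \det F by rewrite mulr_ge0 ?subr_ge0// ltW.
  by lra.
(* The supporting line at the intermediate point is evaluated at both ends of the segment; the two
   inequalities, weighted by t and 1 - t, add up to convexity. *)
have [s sP] := W0_support _ _ G0 H0.
have := sP (- t); have := sP (1 - t).
have -> : F + t *: H + (1 - t) *: H = F + H.
  by rewrite -addrA -scalerDl addrCA subrr addr0 scale1r.
have -> : F + t *: H + (- t) *: H = F by rewrite scaleNr addrK.
move=> /(_ FH0) s1 /(_ F0) s2.
have -> : (1 - t) *: F + t *: (F + H) = F + t *: H.
  by rewrite scalerDr addrA -scalerDl subrK scale1r.
move: s1 s2; move: (W0 F) (W0 (F + H)) (W0 _) => a b g {H F rH F0 FH0 H0 G0 sP} s1 s2.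
have : 0 <= (1 - t) * (a - (g + - t * s)) by rewrite mulr_ge0 ?subr_ge0.
have : 0 <= t * (b - (g + (1 - t) * s)) by rewrite mulr_ge0 ?subr_ge0.
by lra.
Qed.

End RankOneConvexity.

(** * Failure of polyconvexity *)

Section NotPolyconvex.
Variable R : realType.

Lemma W0_not_polyconvex : ~ polyconvex (@W0 R).
Proof.
move=> [P [[_ cP] PW]].
have WP (a d M m : R) : 0 < m -> m <= M -> M ^+ 2 + m ^+ 2 = a ^+ 2 + d ^+ 2 ->
    M * m = a * d -> P (mat2 R a 0 0 d, a * d) = (M / m + 2 * ln m + (M * m)^-1)%:E.
  move=> m0 mM NE DE.
  have <- : \det (mat2 R a 0 0 d) = a * d by rewrite det_mat2 mulr0 subr0.
  rewrite -PW; first by rewrite (W0_mat2 _ _ _ _ _ M m)// ?expr0n ?mulr0 ?addr0 ?subr0.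
  by rewrite /GLp2/= det_mat2 mulr0 subr0 -DE mulr_gt0// (lt_le_trans m0).
have comb (t a d D a' d' D' : R) : (1 - t) *: (mat2 R a 0 0 d, D : R^o) +
    t *: (mat2 R a' 0 0 d', D' : R^o) =
    (mat2 R ((1 - t) * a + t * a') 0 0 ((1 - t) * d + t * d'),
      (1 - t) * D + t * D') :> ('M[R]_2 * R^o)%type.
  apply: injective_projections => //=.
  by rewrite !scale_mat2 add_mat2 !mulr0 addr0.
have half : 0 <= (2^-1 : R) <= 1 by apply/andP; split; lra.
(* The midpoint (diag(27/2, 27/2), 126) is not of the form (F, det F), so [P] is only bounded there.
   Weights 9/25 on (I, 1) and 16/25 on this midpoint then give (9 I, 81). *)
have := cP 2^-1 (mat2 R 21 0 0 6, 21 * 6) (mat2 R 6 0 0 21, 6 * 21) half.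
rewrite comb (WP 21 6 21 6); [|lra..].
rewrite (WP 6 21 21 6); [|lra..].
rewrite -!EFinM -EFinD => le1.
have t01 : 0 <= (16 / 25 : R) <= 1 by apply/andP; split; lra.
have := cP (16 / 25) (mat2 R 1 0 0 1, 1 * 1) 
  (mat2 R ((1 - 2^-1) * 21 + 2^-1 * 6) 0 0 ((1 - 2^-1) * 6 + 2^-1 * 21),
   (1 - 2^-1) * (21 * 6) + 2^-1 * (6 * 21)) t01.
have t0 : (0 <= (16 / 25 : R)%:E)%E by rewrite lee_fin; lra.
move=> /le_trans/(_ (leeD2l _ (lee_wpmul2l t0 le1))).
rewrite (WP 1 1 1 1); [|lra..].
rewrite comb.
have -> : (1 - 16 / 25) * 1 + 16 / 25 * ((1 - 2^-1) * 21 + 2^-1 * 6) = 9 :> R by lra.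
have -> : (1 - 16 / 25) * 1 + 16 / 25 * ((1 - 2^-1) * 6 + 2^-1 * 21) = 9 :> R by lra.
have -> : (1 - 16 / 25) * (1 * 1) +
    16 / 25 * ((1 - 2^-1) * (21 * 6) + 2^-1 * (6 * 21)) = 9 * 9 :> R by lra.
rewrite (WP 9 9 9 9); [|lra..].
rewrite -!EFinM -EFinD lee_fin ln1.
have ln2 : 2 / 3 <= ln (2 : R).
  rewrite (_ : 2 / 3 = 2 * (2 - 1) / (2 + 1)); last by field.
  by apply: ln_ge_pade; lra.
(* With u = 3/2, 9 = 4u^2 and 6 = 4u, so lower bounds for ln 2 and ln(3/2) refute the inequality 1 +
   2 ln 9 + 1/81 <= 18/25 + (16/25)(7/2 + 2 ln 6 + 1/126). *)
have [u [u0 u9 u6 lnu]] : exists u : R,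
    [/\ 0 < u, 9 = u * u * (2 * 2), 6 = u * (2 * 2) & 2 / 5 <= ln u].
  exists (3 / 2); split; [lra..|].
  rewrite (_ : 2 / 5 = 2 * (3 / 2 - 1) / (3 / 2 + 1)); last by field.
  by apply: ln_ge_pade; lra.
have -> : ln 9 = 2 * ln u + 2 * ln 2 by rewrite u9 !lnM ?posrE ?mulr_gt0//; lra.
have -> : ln 6 = ln u + 2 * ln 2 by rewrite u6 !lnM ?posrE ?mulr_gt0//; lra.
by lra.
Qed.

End NotPolyconvex.

(** * Continuity and compactness of sublevel sets *)

Section Topology.
Variable R : realType.
Implicit Types (F : 'M[R]_2).

Lemma continuous_mat2 (T : topologicalType) (a b c d : T -> R) :
  continuous a -> continuous b -> continuous c -> continuous d ->
  continuous (fun t => mat2 R (a t) (b t) (c t) (d t)).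
Proof.
move=> ca cb cc cd t S [P /= Pn PS].
(* A matrix neighbourhood contains a product of entrywise neighbourhoods; [eq_rect] along [mxE]
   turns the one at each entry into a neighbourhood of the function value. *)
have n00 := ca t _ (eq_rect _ (fun x => nbhs x (P 0 0)) (Pn 0 0) _ (mxE _ _ _ _)).
have n01 := cb t _ (eq_rect _ (fun x => nbhs x (P 0 1)) (Pn 0 1) _ (mxE _ _ _ _)).
have n10 := cc t _ (eq_rect _ (fun x => nbhs x (P 1 0)) (Pn 1 0) _ (mxE _ _ _ _)).
have n11 := cd t _ (eq_rect _ (fun x => nbhs x (P 1 1)) (Pn 1 1) _ (mxE _ _ _ _)).
suff : \forall u \near t, S (mat2 R (a u) (b u) (c u) (d u)) by [].
near=> u; apply: PS; apply: ord2P; apply: ord2P; rewrite mxE; near: u.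
- exact: n00.
- exact: n01.
- exact: n10.
- exact: n11.
Unshelve. all: by end_near. Qed.

Lemma continuous_entry (T : topologicalType) (f : T -> 'M[R]_2) i j :
  continuous f -> continuous (fun t => f t i j).
Proof.
move=> cf t; apply: (@continuous_comp _ _ _ f (fun A : 'M[R]_2 => A i j)).
  exact: cf.
exact: coord_continuous.
Qed.

Lemma continuous_mulmx2 (T : topologicalType) (f g : T -> 'M[R]_2) :
  continuous f -> continuous g -> continuous (fun t => f t *m g t).
Proof.
move=> cf cg.
have -> : (fun t => f t *m g t) = (fun t => mat2 R
    (f t 0 0 * g t 0 0 + f t 0 1 * g t 1 0) (f t 0 0 * g t 0 1 + f t 0 1 * g t 1 1)
    (f t 1 0 * g t 0 0 + f t 1 1 * g t 1 0) (f t 1 0 * g t 0 1 + f t 1 1 * g t 1 1)).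
  by apply/funext => t; rewrite [in LHS](mat2K _ (f t)) [in LHS](mat2K _ (g t)) mul_mat2.
by apply: continuous_mat2 => t; apply: cvgD; apply: cvgM; exact: continuous_entry.
Qed.

Definition sqn F : R :=
  F 0 0 * F 0 0 + F 0 1 * F 0 1 + F 1 0 * F 1 0 + F 1 1 * F 1 1.

Lemma continuous_sumsq4 (T : topologicalType) (a b c d : T -> R) :
  continuous a -> continuous b -> continuous c -> continuous d ->
  continuous (fun t => a t * a t + b t * b t + c t * c t + d t * d t).
Proof.
move=> ca cb cc cd t.
by apply: cvgD; [apply: cvgD; [apply: cvgD|]|]; apply: cvgM;
  first [exact: ca|exact: cb|exact: cc|exact: cd].
Qed.

Lemma continuous_cross (T : topologicalType) (a b c d : T -> R) :
  continuous a -> continuous b -> continuous c -> continuous d ->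
  continuous (fun t => a t * d t - b t * c t).
Proof.
move=> ca cb cc cd t.
by apply: cvgB; apply: cvgM; first [exact: ca|exact: cb|exact: cc|exact: cd].
Qed.

Lemma continuous_sqn : continuous sqn.
Proof.
by apply: continuous_sumsq4 => F; exact: coord_continuous.
Qed.

Lemma continuous_det2 : continuous (fun F => \det F).
Proof.
have -> : (fun F => \det F) = (fun F => F 0 0 * F 1 1 - F 0 1 * F 1 0).
  by apply/funext => F; rewrite {1}(mat2K _ F) det_mat2.
by apply: continuous_cross => F; exact: coord_continuous.
Qed.

Lemma W0E F : GLp2 F -> exists M m : R, [/\ 0 < m, m <= M,
  sqn F = M ^+ 2 + m ^+ 2, \det F = M * m & W0 F = M / m + 2 * ln m + (M * m)^-1].
Proof.
rewrite /GLp2/= (mat2K _ F); move: (F 0 0) (F 0 1) (F 1 0) (F 1 1) => a b c d.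
rewrite det_mat2 => /singular_values_exist[M [m [m0 mM NE DE]]].
exists M, m; split=> //; last exact: W0_mat2.
by rewrite NE /sqn !mxE /= !expr2.
Qed.

(** With x = e^(2y) the claim is 4y <= e^(2y), which for y > 0 follows from e^y >= 1 + y and (1 +
    y)^2 >= 4y. *)
Lemma ln_le_half (x : R) : 0 < x -> ln x <= x / 2.
Proof.
move=> x0; have -> : x = expR (ln x / 2) ^+ 2.
  by rewrite -expRM_natl mulrCA mulfV ?mulr1 ?lnK ?posrE// pnatr_eq0.
rewrite lnXn ?expR_gt0// expRK.
have := expR_ge1Dx (ln x / 2); move: (ln x / 2) => y; move: (expR y) => e ye.
have e2 : 0 <= e ^+ 2 by exact: sqr_ge0.
rewrite -mulr_natl; have [y0|y0] := leP y 0; first by lra.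
have : (1 + y) ^+ 2 <= e ^+ 2 by rewrite lerXn2r ?nnegrE//; lra.
by have := sqr_ge0 (1 - y); rewrite sqrrB sqrrD; lra.
Qed.

(** Since x - ln x >= x/2, both K and 1/D are at most 2c. Dropping the other nonnegative terms gives
    ln D <= c, and then M^2 = KD is bounded. *)
Lemma sublevel_bounds (c : R) F : sublevel W0 c F ->
  [/\ 0 < c, (2 * c)^-1 <= \det F & sqn F <= 4 * c * expR c].
Proof.
move=> [F0]; have [M [m [m0 mM NE DE ->]]] := W0E _ F0.
rewrite DE NE => Wc; have M0 : 0 < M by exact: lt_le_trans mM.
have K0 : 0 < M / m by rewrite divr_gt0.
have D0 : 0 < M * m by rewrite mulr_gt0.
have z0 : 0 < (M * m)^-1 by rewrite invr_gt0.
have K1 := ln_le_half _ K0; have z1 := ln_le_half _ z0.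
have W : M / m - ln (M / m) + ((M * m)^-1 - ln (M * m)^-1) <= c.
  by apply: le_trans Wc; rewrite lnV ?posrE// ln_div ?posrE// lnM ?posrE//; lra.
have c0 : 0 < c by lra.
have zc : (M * m)^-1 <= 2 * c by lra.
have Kc : M / m <= 2 * c by lra.
have Dc : M * m <= expR c.
  by rewrite -ler_ln ?posrE ?expR_gt0// expRK; rewrite lnV ?posrE// in z1 W; lra.
split=> //; first by rewrite -[leRHS]invrK lef_pV2 ?posrE// mulr_gt0.
have M2 : M ^+ 2 <= 2 * c * expR c.
  have -> : M ^+ 2 = M / m * (M * m) by field; lra.
  by rewrite ler_pM// ltW.
have : m ^+ 2 <= M ^+ 2 by rewrite lerXn2r ?nnegrE// ltW.
by lra.
Qed.

                                                                                      
                                                                                 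
                                                             
(** A continuous extension of [W0] to all matrices, with the determinant cut off below at [dl]. As
    N^2 - 4D^2 = (M^2 - m^2)^2, [X] is M^2 wherever det >= [dl], and X/D = M/m. *)
Lemma continuous_cutoff (T : topologicalType) (N d : T -> R) (dl : R)
    (D := fun x => Num.max (d x) dl)
    (X := fun x => Num.max ((N x + Num.sqrt (N x * N x - 4 * (d x * d x))) / 2) (D x)) :
  0 < dl -> continuous N -> continuous d ->
  continuous (fun x => X x / D x - ln (X x / D x) + ln (D x) + (D x)^-1).
Proof.
move=> dl0 cN cd x.
have Dx0 : 0 < D x by rewrite lt_max dl0 orbT.
have Xx0 : 0 < X x by rewrite lt_max Dx0 orbT.
have cD : {for x, continuous D}.
  by apply: (@continuous_max R T d (fun=> dl)); [exact: cd|exact: cvg_cst].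
have cX : {for x, continuous X}.
  apply: (@continuous_max R T _ D) => //.
  apply: cvgM; last exact: cvg_cst.
  apply: cvgD; first exact: cN.
  apply: continuous_cvg; first exact: sqrt_continuous.
  apply: cvgB; first by apply: cvgM; exact: cN.
  by apply: cvgM; [exact: cvg_cst|apply: cvgM; exact: cd].
have cV : {for x, continuous (fun y => (D y)^-1)} by apply: cvgV => //; rewrite gt_eqF.
have cQ : {for x, continuous (fun y => X y / D y)} by apply: cvgM.
apply: cvgD => //; apply: cvgD.
  apply: cvgB => //; apply: continuous_cvg; last exact: cQ.
  by apply: continuous_ln; rewrite divr_gt0.
by apply: continuous_cvg; [exact: continuous_ln|exact: cD].
Qed.

Lemma sublevel_closed (c : R) : 0 < c -> closed (sublevel (@W0 R) c).
Proof.
move=> c0; have dl0 : 0 < (2 * c)^-1 by rewrite invr_gt0 mulr_gt0.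
have cW := continuous_cutoff _ _ _ _ dl0 continuous_sqn continuous_det2.
set W := fun F => _ in cW.
have WE F : (2 * c)^-1 <= \det F -> W0 F = W F.
  move=> Fdl; have [M [m [m0 mM NE DE ->]]] := W0E _ (lt_le_trans dl0 Fdl).
  have M0 : 0 < M by exact: lt_le_trans mM.
  rewrite /W (max_idPl Fdl) NE DE.
  have -> : (M ^+ 2 + m ^+ 2) * (M ^+ 2 + m ^+ 2) - 4 * (M * m * (M * m)) =
    (M ^+ 2 - m ^+ 2) ^+ 2 by ring.
  rewrite sqrtr_sqr ger0_norm; last by rewrite subr_ge0 lerXn2r ?nnegrE// ltW.
  have -> : (M ^+ 2 + m ^+ 2 + (M ^+ 2 - m ^+ 2)) / 2 = M * M by field.
  rewrite (max_idPl _); last by rewrite ler_pM2l.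
  rewrite -mulf_div divff ?mul1r ?gt_eqF// ln_div ?posrE// lnM ?posrE//.
  by ring.
(* The a priori bound on det places the sublevel set where [W0] agrees with its extension, so it is
   an intersection of two closed preimages. *)
have -> : sublevel W0 c = (fun F => \det F) @^-1` [set x | (2 * c)^-1 <= x] `&`
    W @^-1` [set x | x <= c].
  apply/seteqP; split => F /=.
    move=> Fc; have [_ Fdl _] := sublevel_bounds _ _ Fc; split=> //.
    by rewrite -WE//; case: Fc.
  by move=> [Fdl]; rewrite -WE// => Wc; split=> //; exact: lt_le_trans Fdl.
apply: closedI.
- by move/continuous_closedP: continuous_det2; apply; exact: closed_ge.
- by move/continuous_closedP: cW; apply; exact: closed_le.
Qed.

Lemma sublevel_compact (c : R) : compact (sublevel (@W0 R) c).
Proof.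
have [c0|c0] := ltP 0 c; last first.
  suff -> : sublevel W0 c = set0 by exact: compact0.
  by apply/seteqP; split => // F /sublevel_bounds[]; rewrite ltNge c0.
(* The added 1 gives B >= 1 wherever x^2 <= B - 1, so that |x| <= B without a square root. *)
pose B := 4 * c * expR c + 1.
pose I := `[- B, B]%classic : set R.
apply: (@subclosed_compact _ _
  ((fun x : (R * R) * (R * R) => mat2 R x.1.1 x.1.2 x.2.1 x.2.2)
     @` ((I `*` I) `*` (I `*` I)))).
- exact: sublevel_closed.
- apply: continuous_compact; last by do ![apply: compact_setX]; exact: segment_compact.
  apply: continuous_subspaceT; apply: continuous_mat2 => x.
  + by apply: continuous_comp; apply: cvg_fst.
  + by apply: continuous_comp; [apply: cvg_fst|apply: cvg_snd].
  + by apply: continuous_comp; [apply: cvg_snd|apply: cvg_fst].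
  + by apply: continuous_comp; apply: cvg_snd.
- move=> F /sublevel_bounds[_ _ NB].
  exists ((F 0 0, F 0 1), (F 1 0, F 1 1)); last by rewrite /= -mat2K.
  have bnd (x : R) : x * x <= 4 * c * expR c -> I x.
    by move=> xB; rewrite /I /= in_itv/=; apply/andP; split; rewrite /B; nra.
  have [h00 h01] := (sqr_ge0 (F 0 0), sqr_ge0 (F 0 1)).
  have [h10 h11] := (sqr_ge0 (F 1 0), sqr_ge0 (F 1 1)).
  rewrite !expr2 in h00 h01 h10 h11; move: NB; rewrite /sqn => NB.
  by split; split; apply: bnd => /=; lra.
Qed.

End Topology.

(** * Connectedness of sublevel sets *)

Section Connectedness.
Variable R : realType.

Definition rot (x : R) : 'M[R]_2 := mat2 R (cos x) (- sin x) (sin x) (cos x).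

Lemma rot_SO2 (x : R) : SO2 (rot x).
Proof. by apply: mat2_SO2; exact: cos2Dsin2. Qed.

Lemma SO2_rot Q : SO2 Q -> exists x, Q = rot x.
Proof.
move=> /SO2_mat2[x [y [xy ->]]].
have x1 : -1 <= x <= 1 by have y2 := sqr_ge0 y; apply/andP; split; nra.
have sx : sin (acos x) = `|y|.
  by rewrite sin_acos// -xy addrAC subrr add0r sqrtr_sqr.
have cx : cos (acos x) = x by apply: acosK; rewrite in_itv.
have [y0|y0] := leP 0 y.
  by exists (acos x); rewrite /rot sx cx ger0_norm.
by exists (- acos x); rewrite /rot cosN sinN sx cx ltr0_norm// !opprK.
Qed.

Lemma continuous_rot (x : R) : continuous (fun t : R => rot (t * x)).
Proof.
have cx : continuous (fun t : R => t * x).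
  by move=> t; apply: cvgM; [exact: cvg_id|exact: cvg_cst].
have cc : continuous (fun t : R => cos (t * x)).
  by move=> t; apply: continuous_comp (cx t) (@continuous_cos R _).
have cs : continuous (fun t : R => sin (t * x)).
  by move=> t; apply: continuous_comp (cx t) (@continuous_sin R _).
by apply: continuous_mat2 => //t; apply: cvgN; exact: cs.
Qed.

Definition expdiag (x y : R) : 'M[R]_2 := mat2 R (expR x) 0 0 (expR y).

Lemma continuous_expdiag (x y : R) : continuous (fun t : R => expdiag (t * x) (t * y)).
Proof.
have cx z : continuous (fun t : R => expR (t * z)).
  move=> t; apply: continuous_cvg; first exact: continuous_expR.
  by apply: cvgM; [exact: cvg_id|exact: cvg_cst].
by apply: continuous_mat2 => // t; exact: cvg_cst.
Qed.

Lemma GLp2_expdiag (x y : R) : GLp2 (expdiag x y).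
Proof. by rewrite /GLp2/= det_mat2 mulr0 subr0 mulr_gt0 ?expR_gt0. Qed.

Lemma W0_expdiag (x y : R) : y <= x ->
  W0 (expdiag x y) = (expR (x - y) - (x - y)) + (expR (- (x + y)) + (x + y)).
Proof.
move=> yx; rewrite /expdiag (W0_mat2 _ _ _ _ _ (expR x) (expR y)) ?expR_gt0 ?ler_expR//.
- by rewrite expRK -expRD -expRB -expRN; ring.
- by ring.
- by ring.
Qed.

(** The function e^s - s is convex with minimum at 0. Directly: e^((1-t)x) >= 1 + (1-t)x leaves
    (e^(tx) - 1) x (1 - t), whose first two factors have the same sign. *)
Lemma expR_sub_scale (t x : R) : 0 <= t <= 1 -> expR (t * x) - t * x <= expR x - x.
Proof.
move=> /andP[t0 t1].
have -> : expR x = expR (t * x) * expR ((1 - t) * x).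
  by rewrite -expRD -mulrDl addrCA subrr addr0 mul1r.
have := expR_ge1Dx ((1 - t) * x); set e := expR ((1 - t) * x) => e1.
have p0 := expR_gt0 (t * x); have := expR_ge1Dx (t * x).
have : (x <= 0 -> expR (t * x) <= 1) /\ (0 <= x -> 1 <= expR (t * x)).
  split=> x0; first by rewrite -expR0 ler_expR mulr_ge0_le0.
  by rewrite -[leLHS]expR0 ler_expR mulr_ge0.
move: (expR (t * x)) p0 => p p0 [xn xp] _.
have le1 : p * (1 + (1 - t) * x) <= p * e by rewrite ler_wpM2l// ltW.
suff : 0 <= (p - 1) * x * (1 - t) by lra.
rewrite mulr_ge0 ?subr_ge0//.
have [x0|x0] := leP x 0; first by rewrite mulr_le0// subr_le0 xn.
by rewrite mulr_ge0 ?subr_ge0 ?xp// ltW.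
Qed.

Lemma sublevel_connected (c : R) : connected (sublevel (@W0 R) c).
Proof.
pose S := sublevel (@W0 R) c.
(* A nonempty sublevel set contains the identity and equals its connected component there. *)
suff Sconn F : S F -> [/\ S 1%:M, S F & connected_component S 1%:M F].
  have [[F SF]|S0] := pselect (exists F, S F); last first.
    rewrite (_ : sublevel _ _ = set0); first exact: connected0.
    by apply/seteqP; split => // F SF; apply: S0; exists F.
  rewrite (_ : sublevel W0 c = connected_component S 1%:M).
    exact: component_connected.
  apply/seteqP; split; first by move=> G /Sconn[].
  exact: connected_component_sub.
move=> SF; have [F0 Fc] := SF.
have [Q1 [Q2 [M [m [S1 S2 m0 mM FE]]]]] := svd2 _ _ F0.
have M0 : 0 < M by exact: lt_le_trans mM.
have [x Q1E] := SO2_rot _ S1; have [y Q2E] := SO2_rot _ S2.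
(* The path has singular values M^t and m^t, so ln K and ln D are scaled by t. *)
pose g t := rot (t * x) *m expdiag (t * ln M) (t * ln m) *m rot (t * y).
have cg : continuous g.
  apply: continuous_mulmx2; last exact: continuous_rot.
  by apply: continuous_mulmx2; [exact: continuous_rot|exact: continuous_expdiag].
have g0 : g 0 = 1%:M.
  rewrite /g !mul0r /rot /expdiag cos0 sin0 expR0 oppr0 scalar_mat2.
  by rewrite !mul_mat2; congr mat2; ring.
have g1 : g 1 = F.
  by rewrite /g !mul1r -Q1E -Q2E /expdiag !lnK ?posrE.
have gGL t : GLp2 (g t).
  by rewrite /GLp2/= det_SO2; [exact: GLp2_expdiag|exact: rot_SO2..].
have Wg t : 0 <= t -> W0 (g t) = expR (t * (ln M - ln m)) - t * (ln M - ln m) +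
    (expR (t * - (ln M + ln m)) - t * - (ln M + ln m)).
  move=> t0; rewrite W0_isotropic; [|exact: GLp2_expdiag|exact: rot_SO2..].
  rewrite W0_expdiag; last by rewrite ler_wpM2l// ler_ln ?posrE.
  by rewrite -mulrBr -mulrDr mulrN opprK.
have gS t : 0 <= t <= 1 -> S (g t).
  move=> /[dup] t01 /andP[t0 t1]; split; first exact: gGL.
  apply: le_trans Fc; rewrite -g1 !Wg// !mul1r.
  by apply: lerD; exact: expR_sub_scale.
have I0 : `[0, 1]%classic (0 : R) by rewrite /= in_itv/= lexx ler01.
have I1 : `[0, 1]%classic (1 : R) by rewrite /= in_itv/= lexx ler01.
have gI : g @` `[0, 1]%classic `<=` S 
  by move=> G [t /=]; rewrite in_itv/= => t01 <-; exact: gS.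
split; [by rewrite -g0; apply: gS; rewrite lexx ler01|exact: SF|].
apply: (@connected_component_max _ S (g @` `[0, 1]%classic)).
- by exists 0.
- exact: gI.
- apply: connected_continuous_connected; first exact: segment_connected.
  exact: continuous_subspaceT.
- by exists 1.
Qed.

End Connectedness.

Lemma W0_split (R : realType) (F : 'M[R]_2) : GLp2 F ->
  W0 F = hhat (distortion F) + fvol (\det F).
Proof.
rewrite /GLp2/= (mat2K _ F); move: (F 0 0) (F 0 1) (F 1 0) (F 1 1) => a b c d.
rewrite det_mat2 => /singular_values_exist[M [m [m0 mM NE DE]]].
have [lM lm] := lambda_mat2 _ _ _ _ _ _ _ m0 mM NE DE.
by rewrite /W0 /hhat /fvol /distortion lM lm DE addrA.
Qed.

Theorem proposition3p5 (R : realType) :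
  [/\ (forall F : 'M[R]_2, GLp2 F ->
         W0 F = hhat (distortion F) + fvol (\det F)),
      rank_one_convex (@W0 R),
      isotropic (@W0 R),
      (forall c : R, compact (sublevel W0 c) /\ connected (sublevel W0 c))
    & ~ polyconvex (@W0 R)].
Proof.
split.
- exact: W0_split.
- exact: W0_rank_one_convex.
- exact: W0_isotropic.
- by move=> c; split; [exact: sublevel_compact|exact: sublevel_connected].
- exact: W0_not_polyconvex.
Qed.
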